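(* Let $P\in\mathcal{P}_o^n$ and let $\xi$ be a linear subspace of $\mathbb{R}^n$. Then $$V_P(\xi)^n=X_{1}(P;\xi)^{n}+X_{2}(P;\xi)^{n}+\cdots+X_{\dim\xi}(P;\xi)^{n}.$$
   Context: $\mathcal{P}_o^n$ is the set of polytopes in $\mathbb{R}^n$ with the origin $o$ in their interiors. Let $u_1,\dots,u_N$ be the (distinct) unit outer normal vectors of the facets of $P$. $V_P(\{u_i\})$ is the volume of the convex hull of $o$ and the facet of $P$ with outer normal $u_i$. For a linear subspace $\xi$ of $\mathbb{R}^n$, $V_P(\xi)=V_P(\xi\cap\mathbb{S}^{n-1})=\sum_{\{i:u_i\in\xi\}}V_P(\{u_i\})$. For $k\in\{1,\dots,n\}$, the quantity $X_k(P;\xi)\ge0$ is defined by $$X_{k}(P;\xi)^{n}=\sum_{\substack{u_{i_1}, \ldots, u_{i_n}\in \xi \\ \dim(\mathrm{span}\{u_{i_1},\ldots,u_{i_n}\})=k}} V_{P}(\{u_{i_1}\}) \cdots V_{P}(\{u_{i_n}\}),$$ the sum being over all ordered $n$-tuples $(i_1,\dots,i_n)\in\{1,\dots,N\}^n$ (repetitions allowed) satisfying the two conditions. *)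

(* Defs.v *)
From HB Require Import structures.
From mathcomp Require Import all_boot all_order all_algebra.
From mathcomp Require Import all_classical all_reals all_analysis.

Set Implicit Arguments.
Unset Strict Implicit.
Unset Printing Implicit Defensive.

Import Order.TTheory GRing.Theory Num.Theory.
Import numFieldNormedType.Exports.

Local Open Scope classical_set_scope.
Local Open Scope ring_scope.

Section Polytopes.
Variables (R : realType) (n : nat).
Implicit Types (A P : set 'rV[R]_n) (v x y : 'rV[R]_n).

Definition dot x y : R := \sum_(i < n) x ord0 i * y ord0 i.

Definition conv_hull A : set 'rV[R]_n :=
  smallest (@convex_set R 'rV[R]_n) A.

Definition affine_hull A : set 'rV[R]_n :=
  [set x | exists (m : nat) (p : 'I_m -> 'rV[R]_n) (c : 'I_m -> R),
     [/\ forall i, A (p i), \sum_i c i = 1 & x = \sum_i c i *: p i]].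

Definition has_affine_dim A (d : nat) : Prop :=
  exists (x0 : 'rV[R]_n) (U : {vspace 'rV[R]_n}),
    \dim U = d /\ affine_hull A = [set x | x - x0 \in U].

Definition polytope P : Prop :=
  exists s : seq 'rV[R]_n, P = conv_hull [set` s].

Definition polytope_o P : Prop := polytope P /\ interior P 0.

(* For v <> 0, the intersection of P with its supporting hyperplane of outer
   normal v. *)
Definition face P v : set 'rV[R]_n :=
  [set x | P x /\ forall y, P y -> dot y v <= dot x v].

Definition facet_normal P v : Prop :=
  dot v v = 1 /\ has_affine_dim (face P v) n.-1.

Definition facet_enum P (N : nat) (u : 'I_N -> 'rV[R]_n) : Prop :=
  injective u /\ range u = [set v | facet_normal P v].

Definition box_volume (a b : 'rV[R]_n) : R :=
  \prod_(i < n) Num.max 0 (b ord0 i - a ord0 i).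

(* Lebesgue outer measure on R^n, from countable covers by closed boxes. *)
Definition lebesgue_outer A : \bar R :=
  ereal_inf
    [set (\sum_(0 <= k <oo) (box_volume (ab.1 k) (ab.2 k))%:E)%E
       | ab in [set ab : (nat -> 'rV[R]_n) * (nat -> 'rV[R]_n) |
                 A `<=` \bigcup_k [set x | forall i : 'I_n,
                   ab.1 k ord0 i <= x ord0 i <= ab.2 k ord0 i]]].

(* Only applied below to compact sets, which have finite outer measure. *)
Definition volume A : R := fine (lebesgue_outer A).

Definition cone_volume P v : R :=
  volume (conv_hull ([set 0] `|` face P v)).

Section Enumerated.
Variables (P : set 'rV[R]_n) (N : nat) (u : 'I_N -> 'rV[R]_n).
Variable xi : {vspace 'rV[R]_n}.

Definition cone_volume_in : R :=
  \sum_(i < N | u i \in xi) cone_volume P (u i).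

Definition X_pow (k : nat) : R :=
  \sum_(f : {ffun 'I_n -> 'I_N} |
         [forall j, u (f j) \in xi]
         && (\dim <<[seq u (f j) | j : 'I_n]>>%VS == k))
    \prod_(j < n) cone_volume P (u (f j)).

(* The nonnegative n-th root (for 0 < n) of the nonnegative real X_pow k. *)
Definition Xk (k : nat) : R := X_pow k `^ (n%:R^-1).

End Enumerated.

End Polytopes.

(* Main.v *)
Require Import Defs.
From mathcomp Require Import all_boot all_order all_algebra.
From mathcomp Require Import all_classical all_reals all_analysis.
Import Order.TTheory GRing.Theory Num.Theory.
Local Open Scope ring_scope.

(** Expanding [V_P(xi)^n] gives a sum over all [n]-tuples of facet normals in
    [xi]; each tuple spans a subspace of [xi] which is nonzero, as unit vectors
    are nonzero, so grouping by the dimension of the span gives the right-hand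
    side. *)

Lemma box_volume_ge0 (R : realType) (n : nat) (a b : 'rV[R]_n) :
  0 <= box_volume a b.
Proof. by apply: prodr_ge0 => i _; rewrite le_max lexx. Qed.

Lemma lebesgue_outer_ge0 (R : realType) (n : nat) (A : set 'rV[R]_n) :
  (0 <= lebesgue_outer A)%E.
Proof.
apply: le_ereal_inf_tmp => _ [ab _ <-].
by apply: nneseries_ge0 => k _ _; rewrite lee_fin box_volume_ge0.
Qed.

(** [fine] sends an infinite value to [0], so the sign of the outer measure carries over in every
    case. *)
Lemma cone_volume_ge0 (R : realType) (n : nat) (P : set 'rV[R]_n)
    (v : 'rV[R]_n) : 0 <= cone_volume P v.
Proof. exact/fine_ge0/lebesgue_outer_ge0. Qed.

Lemma X_pow_ge0 (R : realType) (n : nat) (P : set 'rV[R]_n) (N : nat)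
    (u : 'I_N -> 'rV[R]_n) (xi : {vspace 'rV[R]_n}) (k : nat) :
  0 <= X_pow P u xi k.
Proof.
by apply: sumr_ge0 => f _; apply: prodr_ge0 => j _; exact: cone_volume_ge0.
Qed.

(** The exponents [n^-1] and [n] cancel because [n] is nonzero, and the power with exponent [1]
    returns its base because [X_pow] is nonnegative. *)
Lemma Xk_expn (R : realType) (n : nat) (n_gt0 : (0 < n)%N)
    (P : set 'rV[R]_n) (N : nat) (u : 'I_N -> 'rV[R]_n)
    (xi : {vspace 'rV[R]_n}) (k : nat) :
  Xk P u xi k ^+ n = X_pow P u xi k.
Proof.
rewrite /Xk -powR_mulrn ?powR_ge0// -powRrM mulVf ?pnatr_eq0 -?lt0n//.
by rewrite powRr1 ?X_pow_ge0.
Qed.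

Lemma facet_normal_neq0 (R : realType) (n : nat) (P : set 'rV[R]_n)
    (v : 'rV[R]_n) : facet_normal P v -> v != 0.
Proof.
case=> + _; apply: contra_eq_neq => ->.
by rewrite /dot big1 1?eq_sym ?oner_eq0// => i _; rewrite mxE mul0r.
Qed.

(** Distributivity: expanding a product of [n] copies of one sum amounts to choosing a summand [f j]
    in each factor [j]. *)
Lemma cone_volume_in_expn (R : realType) (n : nat) (P : set 'rV[R]_n) (N : nat)
    (u : 'I_N -> 'rV[R]_n) (xi : {vspace 'rV[R]_n}) :
  cone_volume_in P u xi ^+ n =
    \sum_(f : {ffun 'I_n -> 'I_N} | [forall j, u (f j) \in xi])
      \prod_(j < n) cone_volume P (u (f j)).
Proof.
have <- : \prod_(j < n) cone_volume_in P u xi = cone_volume_in P u xi ^+ n.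
  by rewrite prodr_const card_ord.
rewrite /cone_volume_in.
rewrite (bigA_distr_big (fun i => u i \in xi) (fun _ i => cone_volume P (u i))).
by apply: eq_bigl => f; apply/ffun_onP/forallP.
Qed.

Theorem lemma3p1 (R : realType) (n : nat) (n_gt0 : (0 < n)%N)
    (P : set 'rV[R]_n) (P_poly : polytope_o P)
    (N : nat) (u : 'I_N -> 'rV[R]_n) (u_enum : facet_enum P u)
    (xi : {vspace 'rV[R]_n}) :
  cone_volume_in P u xi ^+ n =
    \sum_(1 <= k < (\dim xi).+1) Xk P u xi k ^+ n.
Proof.
under eq_bigr do rewrite Xk_expn//.
rewrite cone_volume_in_expn /X_pow.
(* The outer sum over [f] retains only the condition free of [k]; the one on the dimension stays in
   the inner sum over [k]. *)
rewrite (exchange_big_dep (fun f : {ffun 'I_n -> 'I_N} =>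
  [forall j, u (f j) \in xi])) /=; last by move=> k f _ /andP[].
apply: eq_bigr => f f_xi; rewrite f_xi /=.
set us := [seq u (f j) | j : 'I_n].
(* For fixed [f] only [k = \dim <<us>>] survives; it remains to place this value between [1] and
   [\dim xi]. *)
rewrite (eq_bigl (pred1 (\dim <<us>>%VS))); last by move=> k; rewrite /= eq_sym.
rewrite -[RHS]big_filter filter_pred1_uniq ?iota_uniq ?big_seq1//.
rewrite mem_index_iota ltnS; apply/andP; split; last first.
  by apply/dimvS/span_subvP => _ /codomP[j ->]; exact: (forallP f_xi).
(* Lower bound: since [0 < n], the tuple has a first entry, a nonzero vector of the span. *)
have uf_us : u (f (Ordinal n_gt0)) \in <<us>>%VS.
  exact/memv_span/codom_f.
have u_neq0 : u (f (Ordinal n_gt0)) != 0.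
  apply: (@facet_normal_neq0 _ _ P); have [_ uE] := u_enum.
  by have : range u (u (f (Ordinal n_gt0))) by []; rewrite uE.
rewrite lt0n dimv_eq0; apply: contraNneq u_neq0 => us0.
by rewrite -memv0 -us0.
Qed.
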